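(* Let $p\ge 3$ be an integer and let $\mathbf{H}=x^2-\partial^2$ be the Hermite operator on $\mathcal{S}(\mathbb{R})$. Then, for every $\phi\in\mathcal{S}(\mathbb{R})$, $$\mathbf{H}^p\phi=\sum_{j=0}^{p}(-1)^{p-j}\binom{p}{j}x^{2j}\partial^{2(p-j)}\phi-2\sum_{r=1}^{p-1}\left(\sum_{j=1}^{r}(-1)^{r-j}\binom{r}{j}\,2j\,x^{2j-1}\partial^{2(r-j)+1}\mathbf{H}^{p-1-r}\phi\right)+R_p\phi,$$ where $R_p\phi$ consists of terms of order $\le 2p-4$, i.e. $R_p\phi$ is a finite linear combination, with constant coefficients not depending on $\phi$, of terms of the form $x^{a}\partial^{b}\phi$ with integers $a,b\ge 0$ and $a+b\le 2p-4$.
   Context: $\mathcal{S}(\mathbb{R})$ is the Schwartz space of real-valued rapidly decreasing smooth functions on $\mathbb{R}$; $\partial$ denotes differentiation, and $x^a$ denotes the operator of multiplication by the monomial $x^a$. The Hermite operator is $(\mathbf{H}\phi)(x)=x^2\phi(x)-\phi''(x)$, $\mathbf{H}^p$ is its $p$-fold composition, and $\mathbf{H}^0$ is the identity. *)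

(* Defs.v *)
From mathcomp Require Import all_boot all_order all_algebra.
From mathcomp Require Import all_classical all_reals all_analysis.
Set Implicit Arguments.
Unset Strict Implicit.
Unset Printing Implicit Defensive.
Import Order.TTheory GRing.Theory Num.Theory.
Import numFieldNormedType.Exports.
Local Open Scope ring_scope.

Definition smooth (R : realType) (phi : R -> R) : Prop :=
  forall (n : nat) (x : R), derivable (derive1n n phi) x 1.

Definition schwartz (R : realType) (phi : R -> R) : Prop :=
  smooth phi /\
  forall a b : nat, exists M : R, forall x : R, `|x ^+ a * derive1n b phi x| <= M.

Definition hermite (R : realType) (phi : R -> R) : R -> R :=
  fun x => x ^+ 2 * phi x - derive1n 2 phi x.

(* On Schwartz functions, T is a finite linear combination, with constant
   coefficients c a b independent of the function, of the operators
   x^a \partial^b with a + b <= N. *)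
Definition order_le (R : realType) (N : nat) (T : (R -> R) -> R -> R) : Prop :=
  exists c : nat -> nat -> R, forall phi : R -> R, schwartz phi ->
    forall x : R, T phi x =
      \sum_(a < N.+1) \sum_(b < N.+1 | (a + b <= N)%N)
        c a b * (x ^+ a * derive1n b phi x).

(* Main.v *)
Require Import Defs.
From HB Require Import structures.
From mathcomp Require Import all_boot all_order all_algebra.
From mathcomp Require Import all_classical all_reals all_analysis.
From mathcomp Require Import zify.
Import Order.TTheory GRing.Theory Num.Theory.
Import numFieldNormedType.Exports.
Local Open Scope ring_scope.

(** Let X be multiplication by x and D differentiation, so that D X = X D + 1 and
H = X^2 - D^2.  The first sum of the theorem is the expansion S_p of
(X^2 - D^2)^p obtained by pretending that X and D commute and writing every X to
the left of every D ([normal_power]).  Multiplying S_r by one more H on the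
left costs only the terms in which D^2 differentiates a power of x:
<<
  H S_r = S_{r+1} - 2 A_r - L_r,
>>
where A_r ([first_correction], order 2r) collects the terms with one derivative
falling on x^{2j}, and L_r ([second_correction], order 2r - 2) those with both
([oscillator_normal_power]).

The remainder is E_n = H^n - S_n + 2 sum_{0<r<n} A_r H^{n-1-r}
([remainder]).  Apply H to E_n and move it to the right of each A_r: this gives
<<
  E_{n+1} = H E_n - L_n - 2 sum_{0<r<n} [H, A_r] H^{n-1-r}
>>
([remainderS]).  A commutator with H does not raise the order
([order_commutator]): exchanging a D with an X leaves a term from which both have
disappeared, and this loss of 2 offsets the order 2 of H.  Hence every term on the right
except the first has order at most 2n - 2 = 2(n+1) - 4, and so has H E_n by
induction, starting from E_1 = 0 ([order_remainder]).

All this uses only linearity and the relation D X = X D + 1, so it is carried out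
for an abstract pair of endomorphisms of a module.  A Schwartz function is then
viewed in the module of smooth functions, which is stable under X and D, and
evaluating at a point turns the abstract identity into the theorem. *)

(** * Operators in normal order for a pair with D X = X D + 1 *)

Section WeylAlgebra.
Set Implicit Arguments.
Unset Strict Implicit.
Variables (R : comNzRingType) (V : lmodType R) (X D : {linear V -> V}).
Hypothesis DX : forall v, D (X v) = X (D v) + v.

Lemma iter_is_linear (f : {linear V -> V}) n : linear (iter n f).
Proof. by elim: n => // n IHn a u v; rewrite !iterS IHn linearP. Qed.

HB.instance Definition _ (f : {linear V -> V}) n :=
  GRing.isLinear.Build R V V *:%R (iter n f) (@iter_is_linear f n).

Definition monomial a b : V -> V := iter a X \o iter b D.

HB.instance Definition _ a b := GRing.Linear.on (monomial a b).

Definition oscillator (v : V) : V := X (X v) - D (D v).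

Lemma oscillator_is_linear : linear oscillator.
Proof.
by move=> a u v; rewrite /oscillator !linearP/= scalerBr scalerN addrACA.
Qed.

HB.instance Definition _ :=
  GRing.isLinear.Build R V V *:%R oscillator oscillator_is_linear.

(** The pairs (a, b) are indexed exactly as in [order_le], so that the coefficients
found here can be reused verbatim for functions. *)
Definition normal_order_le (N : nat) (T : V -> V) : Prop :=
  exists c : nat -> nat -> R, forall v,
    T v = \sum_(a < N.+1) \sum_(b < N.+1 | (a + b <= N)%N)
            c a b *: monomial a b v.

Lemma order_ext N T U : T =1 U -> normal_order_le N T -> normal_order_le N U.
Proof. by move=> TU [c Tc]; exists c => v; rewrite -TU. Qed.

Lemma order0 N : normal_order_le N (fun=> 0).
Proof.
exists (fun _ _ => 0) => v; rewrite big1// => a _.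
by rewrite big1// => b _; rewrite scale0r.
Qed.

Lemma orderD N T U : normal_order_le N T -> normal_order_le N U ->
  normal_order_le N (fun v => T v + U v).
Proof.
move=> [c Tc] [d Ud]; exists (fun a b => c a b + d a b) => v.
rewrite Tc Ud -big_split; apply: eq_bigr => a _.
by rewrite -big_split; apply: eq_bigr => b _; rewrite scalerDl.
Qed.

Lemma orderZ N k T : normal_order_le N T -> normal_order_le N (fun v => k *: T v).
Proof.
move=> [c Tc]; exists (fun a b => k * c a b) => v.
rewrite Tc scaler_sumr; apply: eq_bigr => a _.
by rewrite scaler_sumr; apply: eq_bigr => b _; rewrite scalerA.
Qed.

Lemma orderMn N n T : normal_order_le N T -> normal_order_le N (fun v => T v *+ n).
Proof. by move/(@orderZ N n%:R _); apply: order_ext => v; rewrite scaler_nat. Qed.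

Lemma orderN N T : normal_order_le N T -> normal_order_le N (fun v => - T v).
Proof. by move/(@orderZ N (-1) _); apply: order_ext => v; rewrite scaleN1r. Qed.

Lemma orderB N T U : normal_order_le N T -> normal_order_le N U ->
  normal_order_le N (fun v => T v - U v).
Proof. by move=> oT oU; apply: orderD oT _; apply: orderN. Qed.

Lemma order_sum N (I : eqType) (s : seq I) (P : pred I) (T : I -> V -> V) :
  (forall i, i \in s -> P i -> normal_order_le N (T i)) ->
  normal_order_le N (fun v => \sum_(i <- s | P i) T i v).
Proof.
elim: s => [|i s IHs] oT.
  by apply: order_ext (order0 N) => v; rewrite big_nil.
have {}IHs := IHs (fun j js => oT j (mem_behead (s := i :: s) js)).
case Pi: (P i); last by apply: order_ext IHs => v; rewrite big_cons Pi.
by apply: order_ext (orderD (oT i (mem_head i s) Pi) IHs) => v;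
  rewrite big_cons Pi.
Qed.

Lemma order_monomial N a b : (a + b <= N)%N -> normal_order_le N (monomial a b).
Proof.
move=> abN; exists (fun i j => ((i == a) && (j == b))%:R) => v.
have aN : (a < N.+1)%N by lia.
have bN : (b < N.+1)%N by lia.
rewrite (bigD1 (Ordinal aN))//= (bigD1 (Ordinal bN))//= !eqxx scale1r.
rewrite !big1 ?addr0// => [i|j /andP[_]]; rewrite -val_eqE/=.
  by move=> /negPf ia; rewrite big1// => j _; rewrite ia scale0r.
by move=> /negPf->; rewrite scale0r.
Qed.

Lemma order_mono N M T : (N <= M)%N -> normal_order_le N T -> normal_order_le M T.
Proof.
move=> NM [c Tc].
suff : normal_order_le M (fun v =>
    \sum_(a < N.+1) \sum_(b < N.+1 | (a + b <= N)%N)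
    c a b *: monomial a b v) by apply: order_ext => v; rewrite Tc.
apply: order_sum => a _ _; apply: order_sum => b _ abN.
by apply/orderZ/order_monomial/(leq_trans abN).
Qed.

(** Reduces a bound on the order of L T to the case where T is a monomial. *)
Lemma order_linear N M (L : {linear V -> V}) T :
    (forall a b, (a + b <= N)%N -> normal_order_le M (L \o monomial a b)) ->
  normal_order_le N T -> normal_order_le M (L \o T).
Proof.
move=> oL [c Tc].
suff : normal_order_le M (fun v =>
    \sum_(a < N.+1) \sum_(b < N.+1 | (a + b <= N)%N)
    c a b *: L (monomial a b v)).
  apply: order_ext => v; rewrite /= Tc linear_sum; apply: eq_bigr => a _.
  by rewrite linear_sum; apply: eq_bigr => b _; rewrite linearZ.
apply: order_sum => a _ _; apply: order_sum => b _ abN.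
exact/orderZ/oL.
Qed.

Lemma order_X N T : normal_order_le N T -> normal_order_le N.+1 (X \o T).
Proof.
apply: order_linear => a b abN.
by apply: order_ext (@order_monomial N.+1 a.+1 b _).
Qed.

Lemma D_iterX a v : D (iter a X v) = iter a X (D v) + iter a.-1 X v *+ a.
Proof.
elim: a => [|a IHa]; first by rewrite mulr0n addr0.
rewrite iterS DX IHa linearD linearMn -addrA mulrSr; congr (_ + (_ + _)).
by case: a {IHa}.
Qed.

Lemma order_D N T : normal_order_le N T -> normal_order_le N.+1 (D \o T).
Proof.
apply: order_linear => a b abN.
have : normal_order_le N.+1 (fun v => monomial a b.+1 v + monomial a.-1 b v *+ a).
  by apply: orderD; [|apply: orderMn]; apply: order_monomial; lia.
by apply: order_ext => v /=; rewrite D_iterX.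
Qed.

(** A monomial is a word in X and D, and either letter applied on the left
raises the order by at most one; no commutation past the right factor is
involved. *)
Lemma order_comp N M T U : normal_order_le N T -> normal_order_le M U ->
  normal_order_le (N + M) (T \o U).
Proof.
move=> [c Tc] oU.
suff : normal_order_le (N + M) (fun v =>
    \sum_(a < N.+1) \sum_(b < N.+1 | (a + b <= N)%N)
    c a b *: monomial a b (U v)) by apply: order_ext => v; rewrite /= Tc.
apply: order_sum => a _ _; apply: order_sum => b _ abN; apply: orderZ.
suff : normal_order_le (a + (b + M)) (monomial a b \o U).
  by apply: order_mono; lia.
elim: (a : nat) => [|n IHn]; last exact: order_X.
by elim: (b : nat) => [|n IHn]; last exact: order_D.
Qed.

Lemma order_oscillator N T :
  normal_order_le N T -> normal_order_le N.+2 (oscillator \o T).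
Proof. by move=> oT; apply: orderB; [do 2!apply: order_X|do 2!apply: order_D]. Qed.

Lemma order_iter_oscillator n : normal_order_le (2 * n) (iter n oscillator).
Proof.
elim: n => [|n IHn]; first exact: order_ext (@order_monomial 0 0 0 _).
by rewrite mulnS; apply: order_oscillator.
Qed.

Lemma iterD_X b v : iter b D (X v) = X (iter b D v) + iter b.-1 D v *+ b.
Proof.
elim: b => [|b IHb]; first by rewrite mulr0n addr0.
rewrite iterS IHb linearD linearMn DX -addrA mulrS; congr (_ + (_ + _)).
by case: b {IHb}.
Qed.

Lemma oscillator_monomial a b v :
  oscillator (monomial a b v) = monomial a.+2 b v - monomial a b.+2 v
    - monomial a.-1 b.+1 v *+ (2 * a) - monomial a.-2 b v *+ (a * a.-1).
Proof.
rewrite /oscillator /monomial/= !(D_iterX, linearD D, linearMn D) mulrnDl.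
rewrite -mulrnA mulnC mul2n -addnn mulrnDr mulnC.
by rewrite !opprD !addrA.
Qed.

Lemma monomial_oscillator a b v :
  monomial a b (oscillator v) = monomial a.+2 b v - monomial a b.+2 v
    + monomial a.+1 b.-1 v *+ (2 * b) + monomial a b.-2 v *+ (b * b.-1).
Proof.
rewrite /oscillator /monomial/= (linearB (iter b D))/=.
rewrite !iterD_X (linearD X) (linearMn X) mulrnDl -mulrnA.
rewrite !(linearB (iter a X), linearD (iter a X), linearMn (iter a X))/=.
rewrite -!iterSr !iterS mulnC mul2n -addnn mulrnDr addrC !addrA.
by rewrite [- _ + _]addrC.
Qed.

(** The top terms x^{a+2} D^b and x^a D^{b+2} of H T and T H agree for a monomial T;
in each surviving term one X and one D have been consumed by the commutation. *)
Lemma order_commutator N T : normal_order_le N T ->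
  normal_order_le N (fun v => oscillator (T v) - T (oscillator v)).
Proof.
move=> [c Tc].
suff : normal_order_le N (fun v =>
    \sum_(a < N.+1) \sum_(b < N.+1 | (a + b <= N)%N)
    c a b *: (oscillator (monomial a b v) - monomial a b (oscillator v))).
  apply: order_ext => v; rewrite !Tc linear_sum -sumrB; apply: eq_bigr => a _.
  by rewrite linear_sum -sumrB; apply: eq_bigr => b _; rewrite linearZ -scalerBr.
apply: order_sum => a _ _; apply: order_sum => b _ abN; apply: orderZ.
(* The truncated exponents a.-1, a.-2, b.-1, b.-2 exceed the allowed order only
   where the coefficient vanishes. *)
have oMn i j k : (0 < k -> i + j <= N)%N ->
    normal_order_le N (fun v => monomial i j v *+ k).
  case: k => [|k] ijN; first exact: order_ext (order0 N).
  exact/orderMn/order_monomial/ijN.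
have : normal_order_le N (fun v =>
    - (monomial a.-1 b.+1 v *+ (2 * a)) - monomial a.-2 b v *+ (a * a.-1)
    - monomial a.+1 b.-1 v *+ (2 * b) - monomial a b.-2 v *+ (b * b.-1)).
  apply: orderB; last by apply: oMn => _; lia.
  apply: orderB; last by apply: oMn => ?; lia.
  apply: orderB; last by apply: oMn => _; lia.
  by apply: orderN; apply: oMn => ?; lia.
apply: order_ext => v; rewrite oscillator_monomial monomial_oscillator.
(* u is the common top part of the two products. *)
move: (_ - monomial a b.+2 v) => u; rewrite !opprD !addrA.
by rewrite [_ - u]addrAC [u - _ - u]addrAC subrr add0r.
Qed.

(** * Powers of the oscillator *)

Definition signed_binomial r j : R := (-1) ^+ (r - j) * 'C(r, j)%:R.

(** (X^2 - D^2)^r expanded as if X and D commuted. *)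
Definition normal_power r (v : V) : V :=
  \sum_(0 <= j < r.+1) signed_binomial r j *: monomial (2 * j) (2 * (r - j)) v.

(** Half of what D^2 contributes to H S_r when one of its two derivatives falls on
the power of x: D^2 x^m contains 2m x^{m-1} D. *)
Definition first_correction r (v : V) : V :=
  \sum_(1 <= j < r.+1) (signed_binomial r j * (2 * j)%:R)
     *: monomial (2 * j - 1) (2 * (r - j) + 1) v.

(** What D^2 contributes to H S_r when both derivatives fall on the power of x. *)
Definition second_correction r (v : V) : V :=
  \sum_(1 <= j < r.+1) (signed_binomial r j * (2 * j * (2 * j).-1)%:R)
     *: monomial (2 * j).-2 (2 * (r - j)) v.

Lemma signed_binomialS r j : (j <= r)%N ->
  signed_binomial r.+1 j.+1 = signed_binomial r j - signed_binomial r j.+1.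
Proof.
rewrite /signed_binomial subSS binS natrD mulrDr leq_eqVlt => /predU1P[->|jr].
  by rewrite bin_small// !mulr0 add0r subr0.
by rewrite addrC -mulNr -[- _ ^+ _]mulN1r -exprS subnSK.
Qed.

Lemma signed_binomial_out r : signed_binomial r r.+1 = 0.
Proof. by rewrite /signed_binomial bin_small// mulr0. Qed.

(** With u_j = X^{2j} D^{2(r+1-j)}, this is (X^2 - D^2)(X^2 - D^2)^r =
(X^2 - D^2)^{r+1} in commuting variables. *)
Lemma signed_binomial_pascal r (u : nat -> V) :
  \sum_(0 <= j < r.+1) signed_binomial r j *: (u j.+1 - u j)
    = \sum_(0 <= j < r.+2) signed_binomial r.+1 j *: u j.
Proof.
transitivity (\sum_(0 <= j < r.+1) signed_binomial r j *: u j.+1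
              - \sum_(0 <= j < r.+2) signed_binomial r j *: u j).
  rewrite [in X in _ - X]big_nat_recr//= signed_binomial_out scale0r addr0.
  by rewrite -sumrB; apply: eq_bigr => j _; rewrite scalerBr.
rewrite !(big_nat_recl r.+1)//= opprD addrCA -sumrB.
congr (_ + _).
  by rewrite -scaleNr /signed_binomial !bin0 !subn0 exprS mulN1r mulNr.
apply: eq_big_nat => j /andP[_ jr]; rewrite -scalerBl signed_binomialS//.
Qed.

Lemma oscillator_normal_power r v :
  oscillator (normal_power r v)
    = normal_power r.+1 v - first_correction r v *+ 2 - second_correction r v.
Proof.
pose u j := monomial (2 * j) (2 * (r.+1 - j)) v.
rewrite -[normal_power r.+1 v](signed_binomial_pascal r u) linear_sum.
(* Both corrections vanish at j = 0, so that all sums share the range of S_r. *)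
have -> : first_correction r v = \sum_(0 <= j < r.+1)
    (signed_binomial r j * (2 * j)%:R) *: monomial (2 * j).-1 (2 * (r - j)).+1 v.
  rewrite [RHS]big_ltn// muln0 mulr0 scale0r add0r.
  by apply: eq_bigr => j _; rewrite subn1 addn1.
have -> : second_correction r v = \sum_(0 <= j < r.+1)
    (signed_binomial r j * (2 * j * (2 * j).-1)%:R)
      *: monomial (2 * j).-2 (2 * (r - j)) v.
  by rewrite [RHS]big_ltn// muln0 mulr0 scale0r add0r.
rewrite -sumrMnl -!sumrB; apply: eq_big_nat => j /andP[_ jr].
rewrite linearZ/= oscillator_monomial /u subSS mulnS.
have -> : (2 * (r.+1 - j) = (2 * (r - j)).+2)%N by lia.
rewrite !scalerBr -!scalerA !scaler_nat [(2 * (2 * j))%N]mulnC mulrnA.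
by rewrite !scalerMnr [_ *+ 2 *+ _]mulrnAC.
Qed.

Lemma order_first_correction r : normal_order_le (2 * r) (first_correction r).
Proof.
apply: order_sum => j; rewrite mem_index_iota => jr _.
by apply/orderZ/order_monomial; lia.
Qed.

Lemma order_second_correction r : normal_order_le (2 * r - 2) (second_correction r).
Proof.
apply: order_sum => j; rewrite mem_index_iota => jr _.
by apply/orderZ/order_monomial; lia.
Qed.

Definition remainder n (v : V) : V :=
  iter n oscillator v - normal_power n v
    + (\sum_(1 <= r < n) first_correction r (iter (n - 1 - r) oscillator v)) *+ 2.

(** The summand r = n of the next remainder absorbs the correction 2 A_n coming
from H S_n; the others differ from H applied to the old ones by a commutator. *)
Lemma remainderS n v : (0 < n)%N ->
  remainder n.+1 v = oscillator (remainder n v) - second_correction n v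
    - (\sum_(1 <= r < n)
         (oscillator (first_correction r (iter (n - 1 - r) oscillator v))
          - first_correction r (oscillator (iter (n - 1 - r) oscillator v)))) *+ 2.
Proof.
move=> n_gt0; rewrite /remainder (linearD oscillator) (linearB oscillator)/=.
rewrite oscillator_normal_power sumrB mulrnBl (linearMn oscillator).
rewrite (linear_sum oscillator).
rewrite big_nat_recr//= subn1 subnn/= mulrnDl.
have -> : \sum_(1 <= r < n) first_correction r (iter (n - r) oscillator v)
    = \sum_(1 <= r < n)
        first_correction r (oscillator (iter (n - 1 - r) oscillator v)).
  apply: eq_big_nat => r /andP[_ rn]; rewrite -iterS.
  by congr (first_correction r (iter _ oscillator v)); lia.
move: (first_correction n v *+ 2)
  ((\sum_(1 <= r < n) first_correction r _) *+ 2)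
  ((\sum_(1 <= r < n) oscillator _) *+ 2) => F2 FH2 HF2.
rewrite !opprD !opprK !addrA.
by rewrite [_ + HF2 - _]addrAC !addrK addrAC.
Qed.

Lemma remainder1 v : remainder 1 v = 0.
Proof.
rewrite /remainder big_geq// mul0rn addr0 /normal_power big_nat_recl// big_nat1.
rewrite /signed_binomial/= !subn0 subnn expr1 expr0 !mulr1 scaleN1r scale1r.
by rewrite [- _ + _]addrC subrr.
Qed.

(** The induction starts at n = 2 from E_1 = 0: the truncated 2n - 4 is already 0
at n = 1, where H E_1 would only be known to have order 2. *)
Lemma order_remainder n : (2 <= n)%N -> normal_order_le (2 * n - 4) (remainder n).
Proof.
have step m : (0 < m)%N ->
    normal_order_le (2 * m - 2) (fun v => oscillator (remainder m v)) ->
  normal_order_le (2 * m - 2) (remainder m.+1).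
  move=> m_gt0 oH; apply: (order_ext (fun v => esym (remainderS v m_gt0))).
  apply: orderB; first exact: orderB oH (order_second_correction m).
  apply: orderMn; apply: order_sum => r; rewrite mem_index_iota => rm _.
  have -> : (2 * m - 2 = 2 * r + 2 * (m - 1 - r))%N by lia.
  exact: (order_comp (order_commutator (order_first_correction r))
    (order_iter_oscillator _)).
elim: n => // n IHn; rewrite ltnS leq_eqVlt => /predU1P[<-|n1].
  apply: step => //; apply: order_ext (order0 _) => v.
  by rewrite remainder1 (linear0 oscillator).
have -> : (2 * n.+1 - 4 = 2 * n - 2)%N by lia.
apply: step; first lia.
have -> : (2 * n - 2 = (2 * n - 4).+2)%N by lia.
exact/order_oscillator/IHn.
Qed.

End WeylAlgebra.

(** * The module of smooth functions *)

Section SmoothFunctions.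
Set Implicit Arguments.
Unset Strict Implicit.
Variable R : realType.
Implicit Types f g : R -> R.

Lemma smooth_derivable f x : smooth f -> derivable f x 1.
Proof. by move=> sf; apply: (sf 0). Qed.

Lemma smooth_derive1 f : smooth f -> smooth f^`()%classic.
Proof. by move=> sf n x; rewrite -derive1Sn. Qed.

(** Proves smoothness without a formula for the n-th derivative: it suffices to
find a class of differentiable functions that is closed under derivation. *)
Lemma smooth_coind (K : (R -> R) -> Prop) :
    (forall f, K f -> (forall x, derivable f x 1) /\ K f^`()%classic) ->
  forall f, K f -> smooth f.
Proof.
move=> stepK f Kf n; elim: n f Kf => [|n IHn] f /stepK[df Kdf] x.
  exact: df.
by rewrite derive1Sn; apply: IHn.
Qed.

Lemma derive1_lin (a : R) f g : smooth f -> smooth g ->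
  (a *: f + g)^`()%classic = a *: f^`()%classic + g^`()%classic.
Proof.
move=> sf sg; apply/funext => x; rewrite derive1E.
rewrite deriveD; [|exact/derivableZ/smooth_derivable|exact/smooth_derivable].
by rewrite deriveZ; [rewrite -!derive1E|exact/smooth_derivable].
Qed.

Lemma smooth_lin (a : R) f g : smooth f -> smooth g -> smooth (a *: f + g).
Proof.
move=> sf sg.
apply: (@smooth_coind (fun h =>
  exists u v, [/\ smooth u, smooth v & h = a *: u + v])).
  move=> _ [u [v [su sv ->]]]; split => [x|].
    by apply: derivableD; [apply: derivableZ|]; exact: smooth_derivable.
  exists u^`()%classic, v^`()%classic; split; last exact: derive1_lin.
    exact: smooth_derive1.
  exact: smooth_derive1.
by exists f, g; split.
Qed.

Lemma smooth0 : smooth (0 : R -> R).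
Proof.
apply: (@smooth_coind (eq 0)) => [_ <-|]; last by [].
by split=> [x|]; [exact: derivable_cst|apply/funext => x; rewrite derive1_cst].
Qed.

Definition mul_id f : R -> R := fun x => x * f x.

Lemma derive1_mul_id f : smooth f ->
  (mul_id f)^`()%classic = mul_id f^`()%classic + f.
Proof.
move=> sf; apply/funext => x; rewrite derive1E.
rewrite -[mul_id f]/((id : R -> R) * f) deriveM; last 2 first.
- exact: derivable_id.
- exact: smooth_derivable.
by rewrite derive_id -derive1E /GRing.scale/= mulr1.
Qed.

(** The functions x u + v with u and v smooth form a class closed under
derivation, since (x u + v)' = x u' + (u + v'). *)
Lemma smooth_mul_id f : smooth f -> smooth (mul_id f).
Proof.
move=> sf.
apply: (@smooth_coind (fun h =>
  exists u v, [/\ smooth u, smooth v & h = mul_id u + v])).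
  move=> _ [u [v [su sv ->]]]; split => [x|].
    apply: derivableD; last exact: smooth_derivable.
    by apply: derivableM; [exact: derivable_id|exact: smooth_derivable].
  (* 1 *: u puts u + v' in the form handled by smooth_lin. *)
  exists u^`()%classic, (1 *: u + v^`()%classic).
  split; [exact: smooth_derive1|exact/smooth_lin/smooth_derive1|].
  apply/funext => x; rewrite derive1E deriveD; last exact: smooth_derivable.
    by rewrite -!derive1E derive1_mul_id// scale1r addrA.
  by apply: derivableM; [exact: derivable_id|exact: smooth_derivable].
by exists f, 0; split; [exact: sf|exact: smooth0|rewrite addr0].
Qed.

Definition smooth_pred : {pred R -> R} := fun f => `[< smooth f >].

Lemma smooth_submod_closed : submod_closed smooth_pred.
Proof.
split=> [|a f g /asboolP sf /asboolP sg]; apply/asboolP; first exact: smooth0.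
exact: smooth_lin.
Qed.

HB.instance Definition _ :=
  GRing.isSubmodClosed.Build R (R -> R) smooth_pred smooth_submod_closed.

(** On this module differentiation is a linear endomorphism, which it is not on
all functions. *)
Record smoothFun := SmoothFun {
  smooth_val : R -> R;
  _ : smooth_val \in smooth_pred
}.

HB.instance Definition _ := [isSub for smooth_val].
HB.instance Definition _ := [Choice of smoothFun by <:].
HB.instance Definition _ := [SubChoice_isSubLmodule of smoothFun by <:].

Lemma smooth_valP (f : smoothFun) : smooth (smooth_val f).
Proof. by case: f => f fP; apply/asboolP. Qed.
Arguments smooth_valP : clear implicits.

Definition to_smooth f (sf : smooth f) : smoothFun :=
  @SmoothFun f (asboolT sf).

Definition position (f : smoothFun) :=
  to_smooth (smooth_mul_id (smooth_valP f)).

Definition derivation (f : smoothFun) :=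
  to_smooth (smooth_derive1 (smooth_valP f)).

Lemma position_is_linear : linear position.
Proof.
move=> a f g; apply/val_inj/funext => x /=.
by rewrite /mul_id/= /GRing.scale/= mulrDr mulrCA.
Qed.

Lemma derivation_is_linear : linear derivation.
Proof.
move=> a f g; apply: val_inj.
exact: (derive1_lin a (smooth_valP f) (smooth_valP g)).
Qed.

HB.instance Definition _ :=
  GRing.isLinear.Build R smoothFun smoothFun *:%R position position_is_linear.
HB.instance Definition _ :=
  GRing.isLinear.Build R smoothFun smoothFun *:%R derivation derivation_is_linear.

Lemma derivation_position (f : smoothFun) :
  derivation (position f) = position (derivation f) + f.
Proof. by apply: val_inj; exact: (derive1_mul_id (smooth_valP f)). Qed.

(** Evaluation at a point as a linear form, so that it passes through the sums
that define the operators above. *)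
Definition evaluation (x : R) (f : smoothFun) : R := smooth_val f x.

Lemma evaluation_is_scalar x : scalar (evaluation x).
Proof. by []. Qed.

HB.instance Definition _ x :=
  GRing.isLinear.Build R smoothFun R *%R (evaluation x) (evaluation_is_scalar x).

Lemma evaluation_monomial a b (f : smoothFun) x :
  evaluation x (monomial position derivation a b f)
    = x ^+ a * derive1n b (smooth_val f) x.
Proof.
rewrite /monomial /evaluation/=; elim: a => [|a IHa] /=.
  by rewrite mul1r; elim: b x => // b IHb x; rewrite /= (funext IHb).
by rewrite /mul_id IHa exprS mulrA.
Qed.

Lemma smooth_val_oscillator (f : smoothFun) :
  smooth_val (oscillator position derivation f) = hermite (smooth_val f).
Proof.
apply/funext => x; rewrite -[LHS]/(evaluation x _).
rewrite -[oscillator _ _ f]/(monomial position derivation 2 0 f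
                             - monomial position derivation 0 2 f).
(* The D^2 parts agree by computation; only x (x f) = x^2 f needs an argument. *)
rewrite [LHS]linearB; congr (_ - _); exact: (evaluation_monomial 2 0).
Qed.

Lemma smooth_val_iter_oscillator n (f : smoothFun) :
  smooth_val (iter n (oscillator position derivation) f)
    = iter n (@hermite R) (smooth_val f).
Proof.
elim: n => [|n IHn]; first by [].
by rewrite iterS smooth_val_oscillator IHn.
Qed.

Lemma evaluation_normal_power r (f : smoothFun) x :
  evaluation x (normal_power position derivation r f) =
    \sum_(0 <= j < r.+1) (-1) ^+ (r - j) * 'C(r, j)%:R * x ^+ (2 * j)
      * derive1n (2 * (r - j)) (smooth_val f) x.
Proof.
rewrite linear_sum; apply: eq_bigr => j _.
by rewrite linearZ/= evaluation_monomial !mulrA.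
Qed.

Lemma evaluation_first_correction r (f : smoothFun) x :
  evaluation x (first_correction position derivation r f) =
    \sum_(1 <= j < r.+1) (-1) ^+ (r - j) * 'C(r, j)%:R * (2 * j)%:R
      * x ^+ (2 * j - 1) * derive1n (2 * (r - j) + 1) (smooth_val f) x.
Proof.
rewrite linear_sum; apply: eq_bigr => j _.
by rewrite linearZ/= evaluation_monomial !mulrA.
Qed.

Lemma evaluation_remainder n (f : smoothFun) x :
  evaluation x (remainder position derivation n f) =
    iter n (@hermite R) (smooth_val f) x
    - evaluation x (normal_power position derivation n f)
    + 2 * \sum_(1 <= r < n) evaluation x (first_correction position derivation r
            (iter (n - 1 - r) (oscillator position derivation) f)).
Proof.
rewrite -smooth_val_iter_oscillator -(linear_sum (evaluation x)).
by rewrite [LHS]linearD linearB linearMn mulr_natl.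
Qed.

End SmoothFunctions.

(** * The expansion of the powers of the Hermite operator *)

Theorem lemma1p5 (R : realType) (p : nat) (hp : (3 <= p)%N) :
  exists Rp : (R -> R) -> R -> R,
    order_le (2 * p - 4) Rp /\
    forall phi : R -> R, schwartz phi -> forall x : R,
      iter p (@hermite R) phi x =
        \sum_(0 <= j < p.+1)
          (-1) ^+ (p - j) * 'C(p, j)%:R * x ^+ (2 * j) * derive1n (2 * (p - j)) phi x
        - 2 * (\sum_(1 <= r < p) \sum_(1 <= j < r.+1)
            (-1) ^+ (r - j) * 'C(r, j)%:R * (2 * j)%:R * x ^+ (2 * j - 1)
              * derive1n (2 * (r - j) + 1) (iter (p - 1 - r) (@hermite R) phi) x)
        + Rp phi x.
Proof.
pose S (phi : R -> R) x : R := \sum_(0 <= j < p.+1)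
  (-1) ^+ (p - j) * 'C(p, j)%:R * x ^+ (2 * j) * derive1n (2 * (p - j)) phi x.
pose A (phi : R -> R) x : R := \sum_(1 <= r < p) \sum_(1 <= j < r.+1)
  (-1) ^+ (r - j) * 'C(r, j)%:R * (2 * j)%:R * x ^+ (2 * j - 1)
    * derive1n (2 * (r - j) + 1) (iter (p - 1 - r) (@hermite R) phi) x.
(* Defining R_p by difference leaves only the bound on its order to prove. *)
exists (fun phi x => iter p (@hermite R) phi x - (S phi x - 2 * A phi x)).
split=> [|phi _ x]; last by rewrite addrC subrK.
have [c remE] := order_remainder (@derivation_position R) (ltnW hp).
exists c => phi [sphi _] x; pose f := to_smooth sphi.
transitivity (evaluation x (remainder (@position R) (@derivation R) p f)).
  rewrite evaluation_remainder evaluation_normal_power opprB addrA addrAC.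
  congr (_ - _ + 2 * _); apply: eq_bigr => r _.
  by rewrite evaluation_first_correction smooth_val_iter_oscillator.
rewrite remE linear_sum; apply: eq_bigr => a _.
rewrite linear_sum; apply: eq_bigr => b _.
by rewrite linearZ/= evaluation_monomial.
Qed.
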